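(* Let $z\in\mathbb R\setminus\{0\}$ and $\alpha\in(-1,1)$, and let $g\in C_c^\infty(\mathbb R^2)$ be arbitrary with $\int g\,dx=1$. Then the one-point function is given by $$\langle{:}e^{i\sqrt{4\pi}\alpha\varphi(0)}{:}\rangle_{\mathrm{SG}(4\pi,z)}=\langle M_\alpha(g)\rangle_{\mathrm{SG}(4\pi,z)}=\lim_{|x|\to\infty}\sqrt{\langle M_\alpha(g)M_{-\alpha}(T_xg)\rangle_{\mathrm{SG}(4\pi,z)}},$$ where $T_xg(y)=g(y-x)$.
   Context: Sine-Gordon measure. For $m,\epsilon>0$ let $\nu^{\mathrm{GFF}(m,\epsilon)}$ be the centered Gaussian measure on $C^\infty(\mathbb R^2)$ with covariance $\int_{\epsilon^2}^\infty e^{-m^2s}\frac{e^{-|x-y|^2/4s}}{4\pi s}ds$. For bounded $\Lambda\subset\mathbb R^2$ and $z\in\mathbb R$ let $\nu^{\mathrm{SG}(4\pi,z|\Lambda,m,\epsilon)}(d\varphi)\propto \exp[2z\int_\Lambda \epsilon^{-1}\cos(\sqrt{4\pi}\varphi(x))dx]\,\nu^{\mathrm{GFF}(m,\epsilon)}(d\varphi)$, with expectation $\langle\cdot\rangle_{\mathrm{SG}(4\pi,z|\Lambda,m,\epsilon)}$. For $z\ne0$, the massless sine-Gordon measure $\nu^{\mathrm{SG}(4\pi,z)}$ (expectation $\langle\cdot\rangle_{\mathrm{SG}(4\pi,z)}$) is the unique probability measure on $\mathcal S'(\mathbb R^2)$ that is symmetric under $\varphi\mapsto-\varphi$, mixing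 under translations, and satisfies $\langle e^{i(\varphi,f)}\rangle_{\mathrm{SG}(4\pi,z)}=\lim_{\Lambda\to\mathbb R^2}\lim_{m\to0}\lim_{\epsilon\to0}\langle e^{i(\varphi,f)}\rangle_{\mathrm{SG}(4\pi,z|\Lambda,m,\epsilon)}$ for all $f\in C_c^\infty(\mathbb R^2)$ with $\int f\,dx=0$. It is translation invariant. Imaginary multiplicative chaos. Fix a nonnegative radial mollifier $\eta\in C_c^\infty(\mathbb R^2)$ with support in the unit ball and $\int\eta=1$; $\eta_\epsilon(x)=\epsilon^{-2}\eta(x/\epsilon)$. For $\alpha\in(-1,1)$, $M_\alpha(f)$ is the limit in probability under $\nu^{\mathrm{SG}(4\pi,z)}$, as $\epsilon\to0$, of $\epsilon^{-\alpha^2}\int e^{i\sqrt{4\pi}\alpha(\eta_\epsilon*\varphi)(x)}f(x)dx$ (it exists, depends on $\eta$ only through a deterministic multiplicative constant, and has moments of all orders). One-point function. By translation invariance there is a constant, which is nonnegative and denoted $\langle{:}e^{i\sqrt{4\pi}\alpha\varphi(0)}{:}\rangle_{\mathrm{SG}(4\pi,z)}$, such that $\langle M_\alpha(g)\rangle_{\mathrm{SG}(4\pi,z)}=\langle{:}e^{i\sqrt{4\pi}\alpha\varphi(0)}{:}\rangle_{\mathrm{SG}(4\pi,z)}\int g\,dx$ for all $g\in C_c^\infty(\mathbb R^2)$; this is the definition of the one-point function. *)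

(* Defs.v *)
From HB Require Import structures.
From mathcomp Require Import all_boot all_order all_algebra.
From mathcomp Require Import all_classical all_reals all_analysis.
From mathcomp Require Export complex.

Set Implicit Arguments.
Unset Strict Implicit.
Unset Printing Implicit Defensive.

Import Order.TTheory GRing.Theory Num.Theory numFieldNormedType.Exports.

Local Open Scope classical_set_scope.
Local Open Scope ring_scope.
Local Open Scope complex_scope.

(* The norm `|x| of the normed module R * R is the sup norm. It is used for
   boundedness, decay and |x| -> oo, where only its equivalence class matters;
   the Euclidean norm is enorm. *)
Notation plane R := (R * R)%type.

Section calculus.
Variable R : realType.
Implicit Types (f g : plane R -> R) (x y : plane R) (s : seq bool).

Definition leb2 :
    {measure set (measurableTypeR R * measurableTypeR R)%type -> \bar R} :=
  (@lebesgue_measure R \x @lebesgue_measure R)%E.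

Definition enorm x : R := Num.sqrt (x.1 ^+ 2 + x.2 ^+ 2).

Definition dirv (i : bool) : plane R := if i then (0, 1) else (1, 0).

(* iterpd [:: i1; ...; ik] f is the iterated partial derivative
   d_i1 ... d_ik f *)
Definition iterpd s f : plane R -> R :=
  foldr (fun i h => 'D_(dirv i) h : plane R -> R) f s.

Definition smooth f : Prop := forall s,
  continuous (iterpd s f) /\
  forall i x, derivable (iterpd s f) x (dirv i).

Definition test_function f : Prop :=
  smooth f /\ exists r : R, forall x, r < `|x| -> f x = 0.

(* the bound p_n(f) <= B, where
   p_n(f) = sup_{|s| <= n, x} (1 + |x|)^n |d^s f(x)| *)
Definition schwartz_le (n : nat) f (B : R) : Prop := forall s x,
  (size s <= n)%N -> (1 + `|x|) ^+ n * `|iterpd s f x| <= B.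

Definition schwartz f : Prop :=
  smooth f /\ forall n, exists B, schwartz_le n f B.

Definition translate (a : plane R) f : plane R -> R := fun x => f (x - a).

Lemma translate_quotient (a : plane R) f (v x : plane R) :
  (fun h : R => h^-1 *: ((translate a f \o shift x) (h *: v)
    - translate a f x)) =
  (fun h : R => h^-1 *: ((f \o shift (x - a)) (h *: v) - f (x - a))).
Proof. by apply/funext => h /=; rewrite /translate /= addrA. Qed.

Lemma translate_derive (a : plane R) f v x :
  'D_v (translate a f) x = 'D_v f (x - a).
Proof. by rewrite /derive translate_quotient. Qed.

Lemma translate_derivable (a : plane R) f v x :
  derivable f (x - a) v -> derivable (translate a f) x v.
Proof. by rewrite /derivable translate_quotient. Qed.

Lemma iterpd_translate a f s :
  iterpd s (translate a f) = translate a (iterpd s f).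
Proof.
elim: s => //= i s ->; apply/funext => x; exact: translate_derive.
Qed.

Lemma smooth_translate a f : smooth f -> smooth (translate a f).
Proof.
move=> sf s; have [cf df] := sf s; rewrite iterpd_translate; split.
  move=> x; apply: (@continuous_comp _ _ _ (fun y : plane R => y - a)).
    apply: cvgB; [exact: cvg_id|exact: cvg_cst].
  exact: cf.
by move=> i x; apply: translate_derivable.
Qed.

Lemma schwartz_le_translate a n f B : schwartz_le n f B ->
  schwartz_le n (translate a f) ((1 + `|a|) ^+ n * B).
Proof.
move=> fB s x sn; rewrite iterpd_translate /translate.
apply: (@le_trans _ _
  ((1 + `|a|) ^+ n * ((1 + `|x - a|) ^+ n * `|iterpd s f (x - a)|))).
  rewrite mulrA -exprMn ler_wpM2r // lerXn2r ?nnegrE ?addr_ge0 ?mulr_ge0 //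
    ?addr_ge0 //.
  rewrite mulrDl mul1r mulrDr mulr1 -addrA lerD2l.
  apply: (@le_trans _ _ (`|x - a| + `|a|)).
    by rewrite -[in leLHS](subrK a x) ler_normD.
  by rewrite lerD2l lerDl mulr_ge0.
by rewrite ler_wpM2l ?exprn_ge0 ?addr_ge0 // fB.
Qed.

Lemma schwartz_translate a f : schwartz f -> schwartz (translate a f).
Proof.
move=> [sf bf]; split; first exact: smooth_translate.
by move=> n; have [B fB] := bf n; eexists; exact: schwartz_le_translate fB.
Qed.

Lemma translateNK a f : translate (- a) (translate a f) = f.
Proof. by apply/funext => x; rewrite /translate opprK addrK. Qed.

Lemma schwartz_translateE a f : schwartz (translate a f) -> schwartz f.
Proof. by move=> /(schwartz_translate (- a)); rewrite translateNK. Qed.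

Lemma iterpd0 s : iterpd s (fun=> 0) = fun=> 0.
Proof. by elim: s => //= i s ->; apply/funext => x; rewrite derive_cst. Qed.

Lemma smooth0 : smooth (fun=> 0).
Proof.
move=> s; rewrite iterpd0; split; first by move=> x; exact: cvg_cst.
by move=> i x; exact: derivable_cst.
Qed.

End calculus.

Section fields.
Variable R : realType.

(* A tempered distribution is encoded by its extension by 0 from S(R^2) to all
   functions R^2 -> R, so that u f needs no proof that f is Schwartz. *)
Definition is_tempered (u : (plane R -> R) -> R) : Prop :=
  [/\ forall a f g, schwartz f -> schwartz g ->
        u (fun x => a * f x + g x) = a * u f + u g,
      exists C n, forall f B,
        schwartz f -> schwartz_le n f B -> `|u f| <= C * B &
      forall f, ~ schwartz f -> u f = 0].

Record tempered := Tempered {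
  pairing :> (plane R -> R) -> R ;
  temperedP : is_tempered pairing }.

Lemma is_tempered0 : is_tempered (fun=> 0).
Proof.
split=> //; first by move=> a *; rewrite mulr0 addr0.
by exists 0, 0%N => f B _ _; rewrite normr0 mul0r.
Qed.

HB.instance Definition _ := gen_eqMixin tempered.
HB.instance Definition _ := gen_choiceMixin tempered.
HB.instance Definition _ := isPointed.Build tempered (Tempered is_tempered0).

Lemma is_tempered_opp (u : tempered) : is_tempered (fun f => - u f).
Proof.
have [lu [C [n bu]] u0] := temperedP u; split.
- by move=> a f g sf sg; rewrite lu // opprD mulrN.
- by exists C, n => f B sf fB; rewrite normrN bu.
- by move=> f nsf; rewrite u0 // oppr0.
Qed.

Definition topp (u : tempered) : tempered := Tempered (is_tempered_opp u).

Lemma is_tempered_translate (a : plane R) (u : tempered) :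
  is_tempered (fun f => u (translate (- a) f)).
Proof.
have [lu [C [n bu]] u0] := temperedP u; split.
- move=> b f g sf sg.
  by rewrite -(lu b _ _ (schwartz_translate _ sf) (schwartz_translate _ sg)).
- exists (C * (1 + `|- a|) ^+ n), n => f B sf fB; rewrite -mulrA.
  by apply: bu; [exact: schwartz_translate|exact: schwartz_le_translate].
- by move=> f nsf; apply: u0 => /schwartz_translateE.
Qed.

Definition ttranslate (a : plane R) (u : tempered) : tempered :=
  Tempered (is_tempered_translate a u).

Record smooth_field := SmoothField {
  field_val :> plane R -> R ;
  smooth_fieldP : smooth field_val }.

HB.instance Definition _ := gen_eqMixin smooth_field.
HB.instance Definition _ := gen_choiceMixin smooth_field.
HB.instance Definition _ :=
  isPointed.Build smooth_field (SmoothField (@smooth0 R)).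

Definition tempered_cylinders : set (set tempered) :=
  [set A | exists2 f, schwartz f &
     preimage_set_system setT (fun u : tempered => u f) measurable A].

Definition field_cylinders : set (set smooth_field) :=
  [set A | exists x : plane R,
     preimage_set_system setT (fun phi : smooth_field => phi x) measurable A].

End fields.

(* S'(R^2) and C^oo(R^2) with their cylinder sigma-algebras *)
Notation tempered_space R := (g_sigma_algebraType (@tempered_cylinders R)).
Notation field_space R := (g_sigma_algebraType (@field_cylinders R)).

Section sine_gordon.
Variable R : realType.

Local Notation C := (R[i]^o).

Definition expi (t : R) : C := cos t +i* sin t.

Definition Cintegral d (T : measurableType d) (mu : {measure set T -> \bar R})
    (F : T -> C) : C :=
  (\int[mu]_t complex.Re (F t)) +i* (\int[mu]_t complex.Im (F t)).

Definition beta_root : R := Num.sqrt (4 * pi).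

Definition gff_cov (m e : R) (x y : plane R) : R :=
  \int[@lebesgue_measure R]_(s in `[e ^+ 2, +oo[)
    (expR (- (m ^+ 2 * s)) *
     (expR (- (enorm (x - y) ^+ 2 / (4 * s))) / (4 * pi * s))).

Definition is_gff (m e : R) (mu : probability (field_space R) R) : Prop :=
  forall (n : nat) (x : 'I_n -> plane R) (a : 'I_n -> R),
    Cintegral mu
      (fun phi => expi (\sum_(i < n) a i * (phi : smooth_field R) (x i))) =
    (expR (- (2^-1 * \sum_(i < n) \sum_(j < n)
                       a i * a j * gff_cov m e (x i) (x j))))%:C.

Definition sg_weight (z : R) (L : set (plane R)) (e : R)
    (phi : smooth_field R) : R :=
  expR (2 * z * \int[@leb2 R]_(x in L) (e^-1 * cos (beta_root * phi x))).

(* expectation under the regularised sine-Gordon measure whose reference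
   Gaussian measure is mu *)
Definition sg_expect (mu : probability (field_space R) R) (z : R)
    (L : set (plane R)) (e : R) (F : smooth_field R -> C) : C :=
  Cintegral mu (fun phi => (sg_weight z L e phi)%:C * F phi) /
  (\int[mu]_phi sg_weight z L e phi)%:C.

Definition field_pairing (phi : smooth_field R) (f : plane R -> R) : R :=
  \int[@leb2 R]_x (phi x * f x).

Definition bounded_region (L : set (plane R)) : Prop :=
  @measurable _ (measurableTypeR R * measurableTypeR R)%type L /\
  bounded_set L.

(* L -> R^2: the bounded Borel sets directed by inclusion *)
Definition exhaustion : set_system (set (plane R)) :=
  [set P | exists2 L0, bounded_region L0 &
     forall L, bounded_region L -> L0 `<=` L -> P L].

Definition at_infty : set_system (plane R) :=
  [set P | exists r : R, forall x, r < `|x| -> P x].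

(* l = lim_{L -> R^2} lim_{m -> 0+} lim_{e -> 0+} F L m e, the two inner
   limits being required to exist for L large and m small *)
Definition sg_limit (F : set (plane R) -> R -> R -> C) (l : C) : Prop :=
  exists2 F2 : set (plane R) -> C,
    (F2 L @[L --> exhaustion] --> l) &
    \forall L \near exhaustion, exists2 F1 : R -> C,
      (F1 m @[m --> 0^'+] --> F2 L) &
      \forall m \near 0^'+, F L m e @[e --> 0^'+] --> F1 m.

Definition symmetric_law (nu : probability (tempered_space R) R) : Prop :=
  forall A : set (tempered_space R), measurable A ->
    nu (@topp R @^-1` A) = nu A.

Definition translation_invariant
    (nu : probability (tempered_space R) R) : Prop :=
  forall (a : plane R) (A : set (tempered_space R)), measurable A ->
    nu (ttranslate a @^-1` A) = nu A.

Definition mixing (nu : probability (tempered_space R) R) : Prop :=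
  forall A B : set (tempered_space R), measurable A -> measurable B ->
    nu (A `&` ttranslate a @^-1` B) @[a --> at_infty] --> (nu A * nu B)%E.

(* gff m e is meant to satisfy is_gff m e. Invariance already follows from
   mixing by taking A = setT. *)
Record is_massless_sine_gordon
    (gff : R -> R -> probability (field_space R) R) (z : R)
    (nu : probability (tempered_space R) R) : Prop := {
  sg_symmetric : symmetric_law nu ;
  sg_translation_invariant : translation_invariant nu ;
  sg_mixing : mixing nu ;
  sg_charfun : forall f : plane R -> R, test_function f ->
    \int[@leb2 R]_x f x = 0 ->
    sg_limit
      (fun L m e => sg_expect (gff m e) z L e
                      (fun phi => expi (field_pairing phi f)))
      (Cintegral nu (fun phi => expi ((phi : tempered R) f))) }.

Record is_mollifier (eta : plane R -> R) : Prop := {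
  mollifier_test : test_function eta ;
  mollifier_ge0 : forall x, 0 <= eta x ;
  mollifier_radial : forall x y, enorm x = enorm y -> eta x = eta y ;
  mollifier_supp : forall x, 1 < enorm x -> eta x = 0 ;
  mollifier_mass : \int[@leb2 R]_x eta x = 1 }.

(* (eta_e * phi)(x), with eta_e(x) = e^-2 eta(x/e) *)
Definition mollify (eta : plane R -> R) (e : R) (phi : tempered R)
    (x : plane R) : R :=
  phi (fun y => e ^- 2 * eta (e^-1 *: (x - y))).

Definition imc_approx (eta : plane R -> R) (alpha : R) (f : plane R -> R)
    (e : R) (phi : tempered R) : C :=
  (e `^ (- alpha ^+ 2))%:C *
  Cintegral (@leb2 R)
    (fun x => expi (beta_root * alpha * mollify eta e phi x) * (f x)%:C).

(* M is (a version of) the imaginary chaos f |-> M_alpha(f) under nu *)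
Record is_imc (nu : probability (tempered_space R) R) (eta : plane R -> R)
    (alpha : R) (M : (plane R -> R) -> tempered_space R -> C) : Prop := {
  imc_measurable_Re : forall f, test_function f ->
    measurable_fun setT (fun phi => complex.Re (M f phi)) ;
  imc_measurable_Im : forall f, test_function f ->
    measurable_fun setT (fun phi => complex.Im (M f phi)) ;
  imc_cvg_in_probability : forall f, test_function f ->
    forall d : R, 0 < d ->
    nu [set phi | d%:C <= `|imc_approx eta alpha f e phi - M f phi|]
      @[e --> 0^'+] --> 0%E ;
  imc_moments : forall f, test_function f -> forall n : nat,
    nu.-integrable setT
      (fun phi => (complex.Re `|M f phi| ^+ n)%:E) }.

(* c is the one-point function <: e^{i sqrt(4 pi) alpha phi(0)} :>, where
   M = M_alpha *)
Record is_one_point_function (nu : probability (tempered_space R) R)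
    (M : (plane R -> R) -> tempered_space R -> C) (c : R) : Prop := {
  one_point_ge0 : 0 <= c ;
  one_pointE : forall g, test_function g ->
    Cintegral nu (M g) = (c * \int[@leb2 R]_x g x)%:C }.

End sine_gordon.

(* Main.v *)
Require Import Defs.
From HB Require Import structures.
From mathcomp Require Import all_boot all_order all_algebra.
From mathcomp Require Import all_classical all_reals all_analysis.
From mathcomp Require Import measurable_realfun.
From mathcomp Require Import complex ring lra.
Import Order.TTheory GRing.Theory Num.Theory numFieldNormedType.Exports.
Set Implicit Arguments.
Unset Strict Implicit.
Unset Printing Implicit Defensive.
Local Open Scope classical_set_scope.
Local Open Scope ring_scope.

(** Write F for the chaos of order alpha tested against g, and tau_x for the
    translation of fields by -x. Two facts give the theorem.

    Almost surely, the chaos of order -alpha tested against the translate of g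
    by x is the complex conjugate of F o tau_x. Before the limit this is an
    identity: the regularised chaos involves alpha through
    e^(i k alpha (eta_e * phi)(x)) and alpha^2 only, g is real, and the change
    of variable x |-> x + a in the plane moves a translation of g to one of the
    field ([imc_approx_reflect_translate]). It passes to the limit because
    translations preserve the law of the field and a limit in probability is
    unique up to null sets ([imc_reflect_translate]).

    Hence the two-point function is the expectation of
    F * conj (F o tau_x). A mixing measure decorrelates not only events but
    all functions with enough moments ([mixing_Rintegral]), so this expectation
    tends to E F * conj (E F) = c^2, where E F = c is the definition of the
    one-point function and int g = 1. As c >= 0 and the square root with
    nonnegative real part is continuous at c^2, the root tends to c
    ([cvg_sqrtc]).

    The remaining work is a measurability question: uniqueness of the limit and
    invariance under translations say something about the regularised chaos
    only once it is known to be a measurable function of the field. It is an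
    integral over x of a function of the pair (phi, x) that is measurable in
    phi for each x and continuous in x for each phi, hence jointly measurable
    ([measurable_caratheodory]); the continuity in x holds because a tempered
    distribution is bounded by finitely many Schwartz seminorms and, by the mean
    value theorem, translating a Schwartz function by a small t changes each
    seminorm by O(t) ([continuous_tempered_translate]). *)

(** * Measure-preserving maps and real integrals *)

Definition measure_preserving d (T : measurableType d) (R : realType)
    (mu : set T -> \bar R) (tau : T -> T) : Prop :=
  measurable_fun setT tau /\
  forall A, measurable A -> mu (tau @^-1` A) = mu A.

Section measure_preserving.
Context d (T : measurableType d) (R : realType).
Variables (mu : {measure set T -> \bar R}) (tau : T -> T).
Hypothesis mp : measure_preserving mu tau.

Let pushE (D : set T) : measurable D -> pushforward mu tau D = mu D.
Proof. by move=> mD; rewrite /pushforward mp.2. Qed.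

Lemma ge0_integral_measure_preserving (f : T -> \bar R) :
  measurable_fun setT f -> (forall x, 0 <= f x)%E ->
  (\int[mu]_x f (tau x) = \int[mu]_x f x)%E.
Proof.
move=> mf f0; have mtau := mp.1.
have := @ge0_integral_pushforward _ _ _ _ R tau mtau mu setT f measurableT mf
  (fun y _ => f0 y).
rewrite preimage_setT => <-.
by apply: eq_measure_integral => A mA _; exact: pushE.
Qed.

Lemma Rintegral_measure_preserving (f : T -> R) : measurable_fun setT f ->
  \int[mu]_x f (tau x) = \int[mu]_x f x.
Proof.
move=> mf; have mf' : measurable_fun setT (EFin \o f) by exact/measurable_EFinP.
congr fine; rewrite integralE [RHS]integralE; congr (_ - _)%E.
  rewrite -[RHS](ge0_integral_measure_preserving (measurable_funepos mf')
    (funepos_ge0 _)).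
  by apply: eq_integral => x _; rewrite !funeposE.
rewrite -[RHS](ge0_integral_measure_preserving (measurable_funeneg mf')
  (funeneg_ge0 _)).
by apply: eq_integral => x _; rewrite !funenegE.
Qed.

Lemma integrable_measure_preserving (f : T -> R) :
  mu.-integrable setT (EFin \o f) -> mu.-integrable setT (EFin \o (f \o tau)).
Proof.
move=> /integrableP[mf foo]; apply/integrableP; split.
  exact: measurableT_comp mf mp.1.
have mabs : measurable_fun setT (fun x => `|(EFin \o f) x|%E).
  exact: measurableT_comp.
by have -> := ge0_integral_measure_preserving mabs (fun=> abse_ge0 _).
Qed.

End measure_preserving.

Section real_integrals.
Context d (T : measurableType d) (R : realType).
Variable mu : {measure set T -> \bar R}.
Implicit Types f g : T -> R.

Lemma integrable_dominated f g : measurable_fun setT f ->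
  (forall x, `|f x| <= g x) -> mu.-integrable setT (EFin \o g) ->
  mu.-integrable setT (EFin \o f).
Proof.
move=> mf fg; apply: le_integrable => //; first exact/measurable_EFinP.
by move=> x _ /=; rewrite lee_fin (le_trans (fg x)) ?ler_norm.
Qed.

Lemma le_Rintegral_norm f g : measurable_fun setT f ->
  (forall x, `|f x| <= g x) -> mu.-integrable setT (EFin \o g) ->
  `|\int[mu]_x f x| <= \int[mu]_x g x.
Proof.
move=> mf fg ig; have if_ := integrable_dominated mf fg ig.
apply: (le_trans (le_normr_Rintegral measurableT if_)).
by apply: le_Rintegral => //; exact: integrable_norm.
Qed.

Lemma Rintegral_sum (I : Type) (r : seq I) (F : I -> T -> R) :
  (forall i, mu.-integrable setT (EFin \o F i)) ->
  \int[mu]_x (\sum_(i <- r) F i x) = \sum_(i <- r) \int[mu]_x F i x.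
Proof.
move=> iF; pose G := \sum_(i <- r) F i.
suff [] : \int[mu]_x G x = \sum_(i <- r) \int[mu]_x F i x /\
   mu.-integrable setT (EFin \o G).
  by rewrite /G => <- _; apply: eq_Rintegral => x _; rewrite fct_sumE.
rewrite /G; elim/big_rec2 : _ => [|i y1 y2 _ [<- iy]].
  split; first by rewrite -[RHS](mul0r (fine (mu setT))) -Rintegral_cst.
  by rewrite (_ : _ \o _ = cst 0%E)//; exact: integrable0.
split; last by have := integrableD measurableT (iF i) iy.
by rewrite -RintegralD.
Qed.

End real_integrals.

(** The error is measured against 1 + X^2 so that no truncation has to be
    separated from the discretisation: where - (n + 1) <= X < n + 1 a grid of
    step 1 / (n + 1) gives the bound, and elsewhere the step function is 0 while
    |X| <= X^2 / (n + 1). *)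
Lemma step_approximation d (T : measurableType d) (R : realType) (X : T -> R)
    (n : nat) : measurable_fun setT X ->
  exists N (c : 'I_N -> R) (A : 'I_N -> set T),
    (forall k, measurable (A k)) /\
    forall t, `|X t - \sum_(k < N) c k * \1_(A k) t| <= (1 + X t ^+ 2) / n.+1%:R.
Proof.
move=> mX; set m := n.+1.
pose N := (2 * m ^ 2)%N.
exists N, (fun k => (k%:R - (m ^ 2)%:R) / m%:R),
  (fun k => X @^-1` `[(k%:R - (m ^ 2)%:R) / m%:R, (k.+1%:R - (m ^ 2)%:R) / m%:R[).
have m0 : 0 < m%:R :> R by rewrite ltr0n.
split=> [k|t].
  rewrite -[X in measurable X]setTI; exact: mX.
pose y := m%:R * X t + (m ^ 2)%:R.
have inE_ (k : nat) : (t \in X @^-1` `[(k%:R - (m ^ 2)%:R) / m%:R,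
    (k.+1%:R - (m ^ 2)%:R) / m%:R[) = (k%:R <= y < k.+1%:R).
  apply/idP/idP; rewrite inE /= in_itv /= ler_pdivrMr// ltr_pdivlMr// /y.
    by move=> /andP[? ?]; apply/andP; split; lra.
  by move=> /andP[? ?]; apply/andP; split; lra.
have [/andP[y0 yN]|yN] := boolP (0 <= y < N%:R).
  have [k ky] : exists k : nat, k%:R <= y < k.+1%:R.
    exists (Num.truncn y); exact: truncn_itv.
  have kN : (k < N)%N.
    by move/andP : ky => [ky _]; rewrite -(ltr_nat R); exact: le_lt_trans ky yN.
  rewrite (bigD1 (Ordinal kN))//= big1 ?addr0.
    rewrite indicE inE_ ky mulr1.
    apply: (@le_trans _ _ (1 / m%:R)); last first.
      by rewrite ler_pM2r ?invr_gt0// lerDl sqr_ge0.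
    have -> : X t - (k%:R - (m ^ 2)%:R) / m%:R = (y - k%:R) / m%:R.
      by rewrite /y; field; rewrite lt0r_neq0.
    rewrite normrM (ger0_norm (x := m%:R^-1)) ?invr_ge0 ?(ltW m0)//.
    rewrite ler_pM2r ?invr_gt0//.
    move/andP : ky => [k1 k2]; rewrite -natr1 in k2.
    by rewrite ger0_norm; lra.
  move=> i /eqP ik; rewrite indicE inE_.
  have [/andP[i1 i2]|_] := boolP (_ <= _ < _); last by rewrite mulr0.
  exfalso; apply: ik; apply/val_inj => /=; apply/eqP; rewrite eqn_leq.
  move/andP : ky => [k1 k2].
  apply/andP; split; rewrite -ltnS -(ltr_nat R).
    exact: le_lt_trans i1 k2.
  exact: le_lt_trans k1 i2.
rewrite big1 ?subr0; last first.
  move=> i _; rewrite indicE inE_.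
  have [/andP[i1 i2]|_] := boolP (_ <= _ < _); last by rewrite mulr0.
  exfalso; move/negP: yN; apply; apply/andP; split.
    by rewrite (le_trans _ i1).
  by apply: (lt_le_trans i2); rewrite ler_nat.
have mX_ : m%:R <= `|X t|.
  move: yN; rewrite negb_and -!ltNge -leNgt /y /N natrM natrX.
  case/orP => h.
    rewrite ler_normr; apply/orP; right.
    by rewrite -(ler_pM2l m0) -expr2; lra.
  rewrite ler_normr; apply/orP; left.
  by rewrite -(ler_pM2l m0) -expr2; lra.
rewrite ler_pdivlMr// -(real_normK (num_real (X t))).
apply: (@le_trans _ _ (`|X t| ^+ 2)); last by rewrite lerDr.
by rewrite expr2 ler_wpM2l.
Qed.

(** * Mixing for functions with four moments *)

Lemma cvg_sumr (R : realType) (I J : Type) (F : set_system I) {FF : Filter F}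
    (r : seq J) (f : J -> I -> R) (l : J -> R) :
  (forall j, f j a @[a --> F] --> l j) ->
  \sum_(j <- r) f j a @[a --> F] --> \sum_(j <- r) l j.
Proof.
move=> fl; elim: r => [|j r IH].
  under eq_fun do rewrite big_nil; rewrite big_nil; exact: cvg_cst.
under eq_fun do rewrite big_cons; rewrite big_cons; exact: cvgD.
Qed.

Section mixing.
Context d (T : measurableType d) (R : realType) (P : probability T R).
Context (I : Type) (F : set_system I) {FF : Filter F} (tau : I -> T -> T).
Hypothesis mp : forall a, measure_preserving P (tau a).
Hypothesis mix : forall A B, measurable A -> measurable B ->
  P (A `&` tau a @^-1` B) @[a --> F] --> (P A * P B)%E.

Let step N (c : 'I_N -> R) (A : 'I_N -> set T) (t : T) : R :=
  \sum_(k < N) c k * \1_(A k) t.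

Let integrable_indicZ (c : R) (A : set T) : measurable A ->
  P.-integrable setT (EFin \o (fun t => c * \1_A t)).
Proof.
move=> mA; have iA : P.-integrable setT (EFin \o (\1_A : T -> R)).
  exact: integrable_indic.
by have := integrableZl measurableT c iA.
Qed.

Let Rintegral_indicZ (c : R) (A : set T) : measurable A ->
  \int[P]_t (c * \1_A t) = c * fine (P A).
Proof.
move=> mA; rewrite RintegralZl//; last exact: integrable_indic.
by rewrite /Rintegral integral_indic// setIT.
Qed.

Let measurable_step N (c : 'I_N -> R) A :
  (forall k, measurable (A k)) -> measurable_fun setT (step c A).
Proof.
move=> mA; apply: measurable_sum => k; exact: measurable_funM.
Qed.

Let mixing_step N M (c : 'I_N -> R) A (e : 'I_M -> R) B :
  (forall k, measurable (A k)) -> (forall l, measurable (B l)) ->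
  \int[P]_t (step c A t * step e B (tau a t)) @[a --> F] -->
  \int[P]_t step c A t * \int[P]_t step e B t.
Proof.
move=> mA mB.
have mtau a D : measurable D -> measurable (tau a @^-1` D).
  by move=> mD; rewrite -[X in measurable X]setTI; exact: (mp a).1.
rewrite !Rintegral_sum; try by move=> i; exact: integrable_indicZ.
rewrite big_distrlr /= pair_big /=.
rewrite (_ : (fun a => _) = fun a => \sum_(p : 'I_N * 'I_M)
    c p.1 * e p.2 * fine (P (A p.1 `&` tau a @^-1` B p.2))); last first.
  apply/funext => a.
  transitivity (\int[P]_t \sum_(p : 'I_N * 'I_M)
      (c p.1 * e p.2) * \1_(A p.1 `&` tau a @^-1` B p.2) t).
    apply: eq_Rintegral => t _; rewrite /step big_distrlr /= pair_big /=.
    by apply: eq_bigr => p _; rewrite mulrACA indicI.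
  rewrite Rintegral_sum; last first.
    by move=> p; apply: integrable_indicZ; apply: measurableI => //; exact: mtau.
  apply: eq_bigr => p _; rewrite Rintegral_indicZ//.
  by apply: measurableI => //; exact: mtau.
apply: cvg_sumr => p; rewrite !Rintegral_indicZ// mulrACA.
apply: cvgMl_tmp; rewrite -fineM ?fin_num_measure//.
apply: fine_cvg; rewrite fineK; last by rewrite fin_numM ?fin_num_measure.
exact: mix.
Qed.

(** The weight against which step functions approximate X; it dominates |X|,
    and its square is integrable when X has four moments. *)
Let env (X : T -> R) t : R := 1 + X t ^+ 2.

Let step_error (x y s s' : R) (n : nat) :
  `|x - s| <= (1 + x ^+ 2) / n.+1%:R -> `|y - s'| <= (1 + y ^+ 2) / n.+1%:R ->
  `|x * y - s * s'| <=
    ((1 + x ^+ 2) ^+ 2 + (1 + y ^+ 2) ^+ 2) * (3 / n.+1%:R).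
Proof.
move=> xs ys; set v := 1 + x ^+ 2 in xs *; set w := 1 + y ^+ 2 in ys *.
set k := n.+1%:R^-1 in xs ys *.
have k01 : 0 < k <= 1 by rewrite invr_gt0 ltr0n/= invf_le1 ?ltr0n// ler1n.
have [k0 k1] := andP k01.
have v1 : 1 <= v by rewrite lerDl sqr_ge0.
have w1 : 1 <= w by rewrite lerDl sqr_ge0.
have xv : `|x| <= v.
  by rewrite ler_norml /v; apply/andP; split; nra.
have yw : `|y| <= w by rewrite ler_norml /w; apply/andP; split; nra.
have sv : `|s| <= 2 * v.
  have -> : s = x - (x - s) by ring.
  apply: (le_trans (ler_normB _ _)).
  have : v * k <= v * 1 by rewrite ler_wpM2l//; lra.
  lra.
have -> : x * y - s * s' = (x - s) * y + s * (y - s') by ring.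
apply: (le_trans (ler_normD _ _)); rewrite !normrM.
have h1 : `|x - s| * `|y| <= v * k * w by rewrite ler_pM.
have h2 : `|s| * `|y - s'| <= 2 * v * (w * k) by rewrite ler_pM.
apply: (le_trans (lerD h1 h2)).
have -> : v * k * w + 2 * v * (w * k) = (v * w) * (3 * k) by ring.
rewrite ler_wpM2r ?mulr_ge0 ?ltW//.
nra.
Qed.

(** Mixing of events is bilinear, hence holds for step functions. Replacing X
    and Y by the steps of [step_approximation] changes both sides by at most a
    constant over n, uniformly in a: for the left side the error is dominated by
    (1 + X^2)^2 + (1 + (Y o tau_a)^2)^2, whose integral does not depend on a
    since tau_a preserves P. *)
Lemma mixing_Rintegral (X Y : T -> R) :
  measurable_fun setT X -> measurable_fun setT Y ->
  P.-integrable setT (EFin \o (fun t => X t ^+ 4)) ->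
  P.-integrable setT (EFin \o (fun t => Y t ^+ 4)) ->
  \int[P]_t (X t * Y (tau a t)) @[a --> F] --> \int[P]_t X t * \int[P]_t Y t.
Proof.
move=> mX mY iX iY.
have iV (Z : T -> R) : measurable_fun setT Z ->
    P.-integrable setT (EFin \o (fun t => Z t ^+ 4)) ->
    P.-integrable setT (EFin \o (fun t => env Z t ^+ 2)).
  move=> mZ iZ.
  have i2 : P.-integrable setT (EFin \o (fun t => 2 + 2 * Z t ^+ 4)).
    have i2Z := integrableZl measurableT 2 iZ.
    have ic : P.-integrable setT (EFin \o cst (2 : R)).
      exact: finite_measure_integrable_cst.
    by have := integrableD measurableT ic i2Z.
  apply: integrable_dominated i2.
    apply: measurable_funX; apply: measurable_funD => //.
    exact: measurable_funX.
  move=> t; rewrite ger0_norm ?sqr_ge0// /env.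
  have := sqr_ge0 (1 - Z t ^+ 2).
  by rewrite (_ : Z t ^+ 4 = (Z t ^+ 2) ^+ 2) -?exprM//; nra.
have iVX := iV _ mX iX; have iVY := iV _ mY iY.
set K := \int[P]_t env X t ^+ 2 + \int[P]_t env Y t ^+ 2.
have K0 : 0 <= K.
  by rewrite addr_ge0// Rintegral_ge0// => t _; exact: sqr_ge0.
have env1 (Z : T -> R) t : env Z t <= env Z t ^+ 2.
  by rewrite expr2 ler_peMl// /env ?addr_ge0 ?lerDl ?sqr_ge0.
have normenv (Z : T -> R) t : `|Z t| <= env Z t ^+ 2.
  apply: le_trans (env1 Z t); rewrite /env ler_norml; apply/andP; split; nra.
apply/cvgrPdist_le => eps eps0.
(* n makes both replacement errors add up to at most eps / 2 *)
have [n nP] : exists n, (3 * K + 3 * K ^+ 2) / n.+1%:R <= eps / 2.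
  exists (Num.truncn ((3 * K + 3 * K ^+ 2) / (eps / 2))).
  rewrite ler_pdivrMr// [leRHS]mulrC -ler_pdivrMr ?divr_gt0//.
  by apply: ltW; exact: truncnS_gt.
have [N [c [A [mA XA]]]] := step_approximation n mX.
have [M [e [B [mB YB]]]] := step_approximation n mY.
have mSX := measurable_step c mA; have mSY := measurable_step e mB.
have mtau a (Z : T -> R) : measurable_fun setT Z -> measurable_fun setT (Z \o tau a).
  by move=> mZ; exact: measurableT_comp mZ (mp a).1.
have := @mixing_step N M c A e B mA mB => /cvgrPdist_le /(_ _ (divr_gt0 eps0 (ltr0n _ 2))).
apply: filterS => a close.
set EX := \int[P]_t X t; set EY := \int[P]_t Y t.
set SX := \int[P]_t step c A t; set SY := \int[P]_t step e B t.
have k0 : 0 <= n.+1%:R^-1 :> R by rewrite invr_ge0.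
have k1 : n.+1%:R^-1 <= 1 :> R by rewrite invf_le1 ?ltr0n// ler1n.
have iS (Z S : T -> R) : measurable_fun setT Z -> measurable_fun setT S ->
    P.-integrable setT (EFin \o (fun t => env Z t ^+ 2)) ->
    (forall t, `|Z t - S t| <= env Z t / n.+1%:R) ->
    `|\int[P]_t Z t - \int[P]_t S t| <=
      (\int[P]_t env Z t ^+ 2) / n.+1%:R.
  move=> mZ mS iZ ZS.
  have iZ1 := integrable_dominated mZ (normenv Z) iZ.
  have iZk : P.-integrable setT (EFin \o (fun t => env Z t ^+ 2 / n.+1%:R)).
    by have := integrableZr measurableT n.+1%:R^-1 iZ.
  have ZS2 t : `|Z t - S t| <= env Z t ^+ 2 / n.+1%:R.
    by rewrite (le_trans (ZS t))// ler_wpM2r.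
  have mZS : measurable_fun setT (fun t => Z t - S t) by exact: measurable_funB.
  have iD := integrable_dominated mZS ZS2 iZk.
  have iS : P.-integrable setT (EFin \o S).
    have := integrableB measurableT iZ1 iD; congr (_.-integrable _ _).
    by apply/funext => t /=; rewrite -EFinB; congr (_%:E); ring.
  rewrite -RintegralB// -RintegralZr//.
  exact: le_Rintegral_norm.
have EK (Z : T -> R) : measurable_fun setT Z ->
    P.-integrable setT (EFin \o (fun t => env Z t ^+ 2)) ->
    `|\int[P]_t Z t| <= \int[P]_t env Z t ^+ 2.
  by move=> mZ iZ; exact: le_Rintegral_norm.
have hX := iS _ _ mX mSX iVX XA; have hY := iS _ _ mY mSY iVY YB.
have hEX := EK _ mX iVX; have hEY := EK _ mY iVY.
set KX := \int[P]_t env X t ^+ 2 in K K0 nP hX hEX *.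
set KY := \int[P]_t env Y t ^+ 2 in K K0 nP hY hEY *.
have KX0 : 0 <= KX := le_trans (normr_ge0 _) hEX.
have KY0 : 0 <= KY := le_trans (normr_ge0 _) hEY.
rewrite -/EX -/SX in hX hEX; rewrite -/EY -/SY in hY hEY.
have prodE : `|EX * EY - SX * SY| <= 3 * K ^+ 2 / n.+1%:R.
  have hSX : `|SX| <= 2 * KX.
    have -> : SX = EX - (EX - SX) by ring.
    apply: (le_trans (ler_normB _ _)).
    rewrite (_ : 2 * KX = KX + KX * 1); last by ring.
    by apply: lerD => //; apply: (le_trans hX); rewrite ler_wpM2l.
  have -> : EX * EY - SX * SY = (EX - SX) * EY + SX * (EY - SY) by ring.
  apply: (le_trans (ler_normD _ _)); rewrite !normrM.
  have h1 : `|EX - SX| * `|EY| <= KX / n.+1%:R * KY by rewrite ler_pM.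
  have h2 : `|SX| * `|EY - SY| <= 2 * KX * (KY / n.+1%:R) by rewrite ler_pM.
  apply: (le_trans (lerD h1 h2)).
  have -> : KX / n.+1%:R * KY + 2 * KX * (KY / n.+1%:R) =
    (3 * (KX * KY)) / n.+1%:R by ring.
  by rewrite ler_wpM2r// ler_wpM2l// /K; nra.
have intE : `|\int[P]_t (X t * Y (tau a t)) -
    \int[P]_t (step c A t * step e B (tau a t))| <= 3 * K / n.+1%:R.
  have iVYt : P.-integrable setT (EFin \o (fun t => env Y (tau a t) ^+ 2)).
    exact: (integrable_measure_preserving (f := fun t => env Y t ^+ 2) (mp a)).
  have iG := integrableD measurableT iVX iVYt.
  set G := fun t => env X t ^+ 2 + env Y (tau a t) ^+ 2.
  have iG' : P.-integrable setT (EFin \o G) by [].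
  have GE : \int[P]_t G t = K.
    rewrite RintegralD//.
    rewrite (Rintegral_measure_preserving (mp a) (f := fun t => env Y t ^+ 2))//.
    by case/integrableP : iVY => /measurable_EFinP.
  have mYt := mtau a _ mY; have mSYt := mtau a _ mSY.
  have mXY : measurable_fun setT (fun t => X t * Y (tau a t)).
    exact: measurable_funM.
  have mSS : measurable_fun setT (fun t => step c A t * step e B (tau a t)).
    exact: measurable_funM.
  have XYG t : `|X t * Y (tau a t)| <= G t.
    rewrite normrM /G.
    have hx : `|X t| <= env X t.
      by rewrite /env ler_norml; apply/andP; split; nra.
    have hy : `|Y (tau a t)| <= env Y (tau a t).
      by rewrite /env ler_norml; apply/andP; split; nra.
    have := ler_pM (normr_ge0 _) (normr_ge0 _) hx hy.
    by move/le_trans; apply; nra.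
  have iXY := integrable_dominated mXY XYG iG'.
  have iGk : P.-integrable setT (EFin \o (fun t => G t * (3 / n.+1%:R))).
    by have := integrableZr measurableT (3 / n.+1%:R) iG'.
  have mD := measurable_funB mXY mSS.
  have DG t := step_error (XA t) (YB (tau a t)).
  have iD := integrable_dominated mD DG iGk.
  have iSS : P.-integrable setT
      (EFin \o (fun t => step c A t * step e B (tau a t))).
    have := integrableB measurableT iXY iD; congr (_.-integrable _ _).
    by apply/funext => t /=; rewrite -EFinB; congr (_%:E); ring.
  rewrite -RintegralB//.
  rewrite (_ : 3 * K / n.+1%:R = K * (3 / n.+1%:R)); last by ring.
  rewrite -GE -RintegralZr//.
  exact: le_Rintegral_norm.
rewrite distrC in intE.
set I1 := \int[P]_t (step c A t * _) in intE close.
set I0 := \int[P]_t (X t * _) in intE *.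
rewrite -/SX -/SY in close.
have -> : EX * EY - I0 = (EX * EY - SX * SY) + (SX * SY - I1) + (I1 - I0).
  by ring.
have h := le_trans (ler_normD (EX * EY - SX * SY) (SX * SY - I1))
  (lerD prodE close).
apply: (le_trans (ler_normD _ _)); apply: (le_trans (lerD h intE)).
by rewrite [leRHS](splitr eps) addrAC lerD2r addrC -mulrDl.
Qed.

End mixing.

(** * Translations of the plane *)

Section translation_invariance.
Variable R : realType.

(** By uniqueness of the Lebesgue measure on half-open intervals, as
    translation keeps their length. *)
Lemma lebesgue_measure_preserving_shift (a : R) :
  measure_preserving (@lebesgue_measure R)
    (fun x : measurableTypeR R => x + a : measurableTypeR R).
Proof.
pose s := fun x : measurableTypeR R => x + a : measurableTypeR R.
have ms : measurable_fun setT s.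
  by apply: measurable_funD => //; exact: measurable_id.
split=> // A mA.
pose sm : {mfun (measurableTypeR R) >-> (measurableTypeR R)} :=
  HB.pack s (isMeasurableFun.Build _ _ _ _ s ms).
rewrite [RHS](@lebesgue_measure_unique R (pushforward (@lebesgue_measure R) sm))//.
move=> _ [[x y] _ <-] /=.
rewrite /pushforward (_ : _ @^-1` _ = `]x - a, y - a]%classic); last first.
  apply/seteqP; split => z /=; rewrite !in_itv /= ltrBlDr lerBrDr//.
rewrite !lebesgue_measure_itv /= !lte_fin ltrD2r; case: ifP => // _.
by rewrite -!EFinB; congr (_%:E); ring.
Qed.

Lemma leb2_measure_preserving_shift (a : plane R) :
  measure_preserving (@leb2 R)
    (fun x : (measurableTypeR R * measurableTypeR R)%type =>
       x + a : (measurableTypeR R * measurableTypeR R)%type).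
Proof.
pose T2 := (measurableTypeR R * measurableTypeR R)%type.
pose s := fun x : T2 => x + a : T2.
have [m1 p1] := lebesgue_measure_preserving_shift a.1.
have [m2 p2] := lebesgue_measure_preserving_shift a.2.
have ms : measurable_fun setT s.
  apply/measurable_fun_pairP; split.
    exact: (measurableT_comp m1 measurable_fst).
  exact: (measurableT_comp m2 measurable_snd).
split=> // A mA.
pose sm : {mfun T2 >-> T2} := HB.pack s (isMeasurableFun.Build _ _ _ _ s ms).
rewrite [RHS](@product_measure_unique _ _ _ _ R (@lebesgue_measure R)
  (@lebesgue_measure R) (pushforward (@leb2 R) sm))// => B C mB mC.
have mpre (f : measurableTypeR R -> measurableTypeR R) D :
    measurable_fun setT f -> measurable D -> measurable (f @^-1` D).
  by move=> mf mD; rewrite -[X in measurable X]setTI; exact: mf.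
transitivity
    (lebesgue_measure ((fun x : measurableTypeR R => (x + a.1)%R) @^-1` B) *
     lebesgue_measure ((fun x : measurableTypeR R => (x + a.2)%R) @^-1` C))%E; last first.
  by congr (_ * _)%E; [exact: p1|exact: p2].
by rewrite -(product_measure1E _ _ (mpre _ _ m1 mB) (mpre _ _ m2 mC)).
Qed.

End translation_invariance.

(** * Functions measurable in one variable and continuous in the other *)

Section caratheodory.
Context d (T : measurableType d) (R : realType).

(** The function is the limit of (w, t) |-> f (w, t_n), where t_n rounds t down
    to the grid of step 1 / (n + 1); such an approximation only uses countably
    many slices f (., t_n). *)
Lemma measurable_caratheodory (f : T * measurableTypeR R -> R) :
  (forall t, measurable_fun setT (fun w => f (w, t))) ->
  (forall w, continuous (fun t : R => f (w, t))) ->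
  measurable_fun setT f.
Proof.
move=> mf cf.
pose q (n : nat) (t : R) : R := (Num.floor (t * n.+1%:R))%:~R / n.+1%:R.
pose h n (p : T * measurableTypeR R) := f (p.1, q n p.2).
have mh n : measurable_fun setT (h n).
  (* the strips between grid lines, indexed by nat through pickle on int *)
  pose E k := [set p : T * measurableTypeR R | if unpickle k is Some z
    then Num.floor (p.2 * n.+1%:R) = z :> int else False].
  have mE k : measurable (E k).
    rewrite /E; case: (unpickle k) => [z|]; last exact: measurable0.
    rewrite (_ : [set p | _] = setT `*`
      `[z%:~R / n.+1%:R, (z + 1)%:~R / n.+1%:R[%classic).
      exact: measurableX.
    apply/seteqP; split => -[w t] /=.
      move=> tz; split=> //; rewrite in_itv /= ler_pdivrMr// ltr_pdivlMr//.
      by rewrite -tz floor_le floorD1_gt.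
    move=> [_]; rewrite in_itv /= ler_pdivrMr// ltr_pdivlMr// => tz.
    exact/floor_def.
  rewrite (_ : setT = \bigcup_k E k).
    apply/(measurable_fun_bigcup _ mE) => k _ B mB.
    rewrite [X in measurable X](_ : _ = E k `&`
      (if unpickle k is Some z
       then ((fun w => f (w, z%:~R / n.+1%:R)) @^-1` B) `*` setT else set0)).
      apply: measurableI => //; case: (unpickle k) => [z|]; last exact: measurable0.
      apply: measurableX => //; rewrite -[X in measurable X]setTI.
      exact: mf.
    apply/seteqP; split => -[w t] /=; rewrite /E /h /q /=.
      by case: (unpickle k) => [z|[]//] [<- ?].
    by case: (unpickle k) => [z|[]//] [<- [? _]].
  apply/seteqP; split => // p _.
  exists (pickle (Num.floor (p.2 * n.+1%:R))); first by [].
  by rewrite /E /= pickleK.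
apply: (measurable_fun_cvg (h := h)) => // -[w t] _; rewrite /h /=.
apply: (@continuous_cvg _ _ _ _ _ _ (fun t => f (w, t))); first exact: cf.
apply/cvgrPdist_le => e e0.
near=> n.
apply: (@le_trans _ _ n.+1%:R^-1); last first.
  by apply/ltW; near: n; exact: near_infty_natSinv_lt (PosNum e0).
rewrite /q -[X in `|X - _|](mulfK (_ : n.+1%:R != 0))//.
rewrite -mulrBl normrM [X in _ * X]ger0_norm ?invr_ge0//.
rewrite ler_piMl ?invr_ge0//.
have := floor_le (t * n.+1%:R); have := floorD1_gt (t * n.+1%:R).
rewrite intrD => h1 h2; rewrite ger0_norm ?subr_ge0//.
by rewrite lerBlDl ltW.
Unshelve. all: by end_near. Qed.

End caratheodory.

(** * Continuity of translations on tempered distributions *)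

Section schwartz_translation.
Variable R : realType.
Implicit Types (f g : plane R -> R) (u : tempered R) (i : bool).

Lemma iterpd_linear (a : R) f g s : smooth f -> smooth g ->
  iterpd s (fun x => a * f x + g x) =
  (fun x => a * iterpd s f x + iterpd s g x).
Proof.
move=> sf sg; elim: s => //= i s ->; apply/funext => x.
have df := (sf s).2 i x; have dg := (sg s).2 i x.
have -> : (fun x => a * iterpd s f x + iterpd s g x) =
  (a \*: iterpd s f) + iterpd s g by [].
by rewrite deriveD ?deriveZ//; exact: derivableZ.
Qed.

Lemma schwartz_linear (a : R) f g : schwartz f -> schwartz g ->
  schwartz (fun x => a * f x + g x).
Proof.
move=> [sf bf] [sg bg]; split=> [s|n].
  rewrite iterpd_linear//; have [cf df] := sf s; have [cg dg] := sg s.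
  split=> [x|i x].
    by apply: cvgD; [apply: cvgMl_tmp; exact: cf|exact: cg].
  have -> : (fun x => a * iterpd s f x + iterpd s g x) =
    (a \*: iterpd s f) + iterpd s g by [].
  by apply: derivableD => //; exact: derivableZ.
have [B fB] := bf n; have [B' gB'] := bg n.
exists (`|a| * B + B') => s x sn; rewrite iterpd_linear//.
have p0 : 0 <= (1 + `|x|) ^+ n by rewrite exprn_ge0// addr_ge0.
apply: (le_trans (ler_wpM2l p0 (ler_normD _ _))).
rewrite mulrDr normrM mulrCA lerD//; last exact: gB'.
by rewrite ler_wpM2l//; exact: fB.
Qed.

Lemma normr_dirv i : `|dirv R i| = 1.
Proof.
by rewrite /dirv; case: i; rewrite prod_normE /= normr0 normr1;
  [exact/max_idPr|exact/max_idPl].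
Qed.

(** The mean value theorem along the line w + r v, whose derivative at r is the
    partial derivative of f; t may have either sign. *)
Lemma iterpd_mean_value f s i (w : plane R) (t : R) : smooth f ->
  exists2 c : R, `|c| <= `|t| &
    iterpd s f (w + t *: dirv R i) - iterpd s f w =
    t * iterpd (i :: s) f (w + c *: dirv R i).
Proof.
move=> sf; set v := dirv R i.
pose h (r : R) := iterpd s f (w + r *: v).
pose h' (r : R) := iterpd (i :: s) f (w + r *: v).
have hd (r : R) : is_derive r 1 h (h' r).
  have := (sf s).2 i (w + r *: v).
  have e : (fun k : R => k^-1 *: ((h \o shift r) (k *: 1) - h r)) =
    (fun k : R => k^-1 *: ((iterpd s f \o shift (w + r *: v)) (k *: v)
      - iterpd s f (w + r *: v))).
    apply/funext => k; rewrite /h /= scalerDl; congr (_ *: (iterpd s f _ - _)).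
    by rewrite [k *: 1]mulr1 addrCA.
  by rewrite /derivable -e => hr; apply: DeriveDef => //; rewrite /derive e.
have hc (a b : R) : {within `[a, b], continuous h}.
  apply: continuous_subspaceT => r.
  by apply: differentiable_continuous; apply/derivable1_diffP; case: (hd r).
have [t0|t0] := leP 0 t.
  have [c + hE] := MVT_segment t0 (fun r _ => hd r) (@hc _ _).
  rewrite in_itv /= => /andP[c0 ct]; exists c; first by rewrite !ger0_norm.
  by move: hE; rewrite /h /h' scale0r addr0 subr0 mulrC => ->.
have [c + hE] := MVT_segment (ltW t0) (fun r _ => hd r) (@hc _ _).
rewrite in_itv /= => /andP[ct c0]; exists c.
  by rewrite (ltr0_norm t0) ler0_norm// lerN2.
move: hE; rewrite /h /h' scale0r addr0 sub0r => hE.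
by rewrite -opprB hE mulrN opprK mulrC.
Qed.

(** Small translations move a Schwartz function little in every seminorm, at
    the price of one more derivative. The factor 2 ^+ n compares the weights
    (1 + |x|)^n at the two points, which are at distance at most 1. The
    combination is written -1 * f + ... to match the linearity clause of
    tempered distributions. *)
Lemma schwartz_le_increment f i n B (t : R) : smooth f -> `|t| <= 1 ->
  schwartz_le n.+1 f B ->
  schwartz_le n (fun x => -1 * f x + translate (t *: dirv R i) f x)
    (`|t| * (2 ^+ n * B)).
Proof.
move=> sf t1 fB s x sn.
rewrite iterpd_linear//; last exact: smooth_translate.
rewrite iterpd_translate /translate mulN1r [X in _ * `|X|]addrC -scaleNr.
have [c ct ->] := iterpd_mean_value s i x (- t) sf.
rewrite normrN in ct.
set y := x + c *: dirv R i.
have := fB (i :: s) y; rewrite ltnS => /(_ sn) By.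
rewrite normrM normrN mulrCA ler_wpM2l//.
have y1 : 1 <= 1 + `|y| by rewrite lerDl.
apply: (@le_trans _ _ (2 ^+ n * ((1 + `|y|) ^+ n.+1 * `|iterpd (i :: s) f y|))).
  rewrite mulrA ler_wpM2r//.
  apply: (@le_trans _ _ ((2 * (1 + `|y|)) ^+ n)).
    rewrite lerXn2r ?nnegrE ?addr_ge0 ?mulr_ge0 ?addr_ge0//.
    have -> : x = y - c *: dirv R i by rewrite /y addrK.
    have := ler_normB y (c *: dirv R i).
    rewrite normrZ normr_dirv mulr1; lra.
  by rewrite exprMn ler_wpM2l ?exprn_ge0// ler_weXn2l.
by rewrite ler_wpM2l ?exprn_ge0.
Qed.

Lemma continuous_tempered_translate u f i : schwartz f ->
  continuous (fun t : R => u (translate (t *: dirv R i) f)).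
Proof.
move=> Sf t0; set v := dirv R i; set f0 := translate (t0 *: v) f.
have Sf0 : schwartz f0 by exact: schwartz_translate.
have [lu [C [n bu]] _] := temperedP u.
have [B fB] := Sf0.2 n.+1.
set K := `|C * (2 ^+ n * B)|.
have K0 : 0 <= K by exact: normr_ge0.
have incr t : `|t - t0| <= 1 ->
    `|u f0 - u (translate (t *: v) f)| <= `|t - t0| * K.
  move=> tt0.
  have -> : translate (t *: v) f = translate ((t - t0) *: v) f0.
    apply/funext => x; rewrite /f0 /translate scalerBl.
    by congr f; rewrite opprB addrA addrAC addrK.
  have St := schwartz_translate ((t - t0) *: v) Sf0.
  have := bu _ _ (schwartz_linear (-1) Sf0 St)
    (schwartz_le_increment i Sf0.1 tt0 fB).
  rewrite lu// mulN1r addrC distrC => /le_trans; apply.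
  by rewrite mulrCA ler_wpM2l// ler_norm.
apply/cvgrPdist_le => e e0.
have d0 : 0 < Num.min 1 (e / (K + 1)).
  by rewrite lt_min ltr01 divr_gt0// ltr_wpDl.
near=> t.
have : `|t - t0| <= Num.min 1 (e / (K + 1)).
  rewrite distrC; near: t.
  exact: (@cvgr_dist_le _ _ _ _ _ _ _ cvg_id).
rewrite le_min => /andP[t1 te].
apply: (le_trans (incr t t1)).
apply: (@le_trans _ _ (`|t - t0| * (K + 1))).
  by rewrite ler_wpM2l// lerDl.
by rewrite -ler_pdivlMr// ltr_wpDl.
Unshelve. all: by end_near. Qed.

End schwartz_translation.

(** * Measurability of the regularised chaos *)

(** Tonelli applied to the positive and negative parts of h. *)
Lemma measurable_Rintegral_param d1 d2 (T1 : measurableType d1)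
    (T2 : measurableType d2) (R : realType)
    (m : {sigma_finite_measure set T2 -> \bar R}) (h : T1 * T2 -> R) :
  measurable_fun setT h ->
  measurable_fun setT (fun w => \int[m]_x h (w, x)).
Proof.
move=> mh; have mh' : measurable_fun setT (EFin \o h) by exact/measurable_EFinP.
apply: (measurableT_comp (fine_measurable measurableT)) => /=.
rewrite (_ : (fun w => _) = fun w =>
    (\int[m]_x (EFin \o h)^\+ (w, x) - \int[m]_x (EFin \o h)^\- (w, x))%E).
  apply: emeasurable_funB.
    exact: (measurable_fun_fubini_tonelli_F (m2 := m) _ (measurable_funepos mh')
      (funepos_ge0 _)).
  exact: (measurable_fun_fubini_tonelli_F (m2 := m) _ (measurable_funeneg mh')
    (funeneg_ge0 _)).
apply/funext => w; rewrite integralE; congr (_ - _)%E;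
  by apply: eq_integral => x _; rewrite ?funeposE ?funenegE.
Qed.

Local Open Scope complex_scope.

Section measurability.
Variable R : realType.
Local Notation T2 := (measurableTypeR R * measurableTypeR R)%type.
Implicit Types (f g psi eta : plane R -> R).

Lemma sigma_finite_leb2 : sigma_finite setT (@leb2 R).
Proof.
have /sigma_finiteP[F [TF ndF Foo]] := sigma_finiteT (@lebesgue_measure R).
exists (fun n => F n `*` F n : set T2) => [|n]; last first.
  have [mF Fy] := Foo n; split; first exact: measurableX.
  apply: (@le_lt_trans _ _ (lebesgue_measure (F n) * lebesgue_measure (F n))%E).
    by rewrite -(product_measure1E _ _ mF mF).
  by rewrite lte_mul_pinfty// ge0_fin_numE.
apply/seteqP; split => // -[x y] _.
have : [set: measurableTypeR R] x by []; rewrite TF => -[n _ Fnx].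
have : [set: measurableTypeR R] y by []; rewrite TF => -[k _ Fky].
exists (maxn n k) => //; split => /=.
  by move: x Fnx; exact/subsetPset/ndF/leq_maxl.
by move: y Fky; exact/subsetPset/ndF/leq_maxr.
Qed.

(** The plane carries the product sigma-algebra, so this is the separate
    continuity case of [measurable_caratheodory] rather than a statement about
    open sets. *)
Lemma continuous_plane_measurable f : continuous f ->
  measurable_fun setT (f : T2 -> R).
Proof.
move=> cf.
apply: (@measurable_caratheodory _ (measurableTypeR R) R f) => [t|w]; last first.
  move=> t; apply: (@continuous_comp _ _ _ (fun t : R => (w, t) : plane R)).
    by apply: (@cvg_pair _ _ _ _ (nbhs w) (nbhs t)); [exact: cvg_cst|exact: cvg_id].
  exact: cf.
apply: continuous_measurable_fun => x.
apply: (@continuous_comp _ _ _ (fun x : R => (x, t) : plane R)).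
  by apply: (@cvg_pair _ _ _ _ (nbhs x) (nbhs t)); [exact: cvg_id|exact: cvg_cst].
exact: cf.
Qed.

Lemma translateC (a b : plane R) f :
  translate a (translate b f) = translate b (translate a f).
Proof. by apply/funext => z; rewrite /translate addrAC. Qed.

(** For f Schwartz these maps generate the cylinder sigma-algebra; for other f
    they vanish, since a tempered distribution is encoded by its extension
    by 0. *)
Lemma measurable_tempered_pairing f :
  measurable_fun setT (fun phi : tempered_space R => (phi : tempered R) f).
Proof.
have [Sf|nSf] := pselect (schwartz f).
  move=> _ B mB; apply: sub_sigma_algebra; exists f => //.
  by exists B.
rewrite (_ : (fun _ => _) = cst 0) => [|//]; first exact: measurable_cst.
by apply/funext => phi; have [_ _ ->] := temperedP phi.
Qed.

Lemma measurable_ttranslate (a : plane R) :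
  measurable_fun setT (ttranslate a : tempered_space R -> tempered_space R).
Proof.
apply: (@measurability _ _ (tempered_space R) (tempered_space R) setT _
  (@tempered_cylinders R)) => //.
move=> _ [_ [f Sf [B mB <-]] <-].
rewrite !setTI -[X in measurable X]setTI.
exact: (measurable_tempered_pairing (translate (- a) f)).
Qed.

(** The two coordinates of the translation are adjoined one after the other,
    with [measurable_caratheodory] each time; only continuity along the axes is
    then required. *)
Lemma measurable_pairing_translate psi :
  measurable_fun setT (fun p : tempered_space R * T2 =>
    (p.1 : tempered R) (translate p.2 psi)).
Proof.
have [Spsi|nSpsi] := pselect (schwartz psi); last first.
  rewrite (_ : (fun _ => _) = cst 0) => [|//]; first exact: measurable_cst.
  apply/funext => -[phi x]; have [_ _ ->//] := temperedP phi.
  by move=> /schwartz_translateE.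
pose F (q : (tempered_space R * measurableTypeR R) * measurableTypeR R) : R :=
  (q.1.1 : tempered R) (translate (q.1.2, q.2) psi).
(* in either order, as each coordinate has to come first once *)
have trE (x y : R) : translate (x, y) psi =
    translate (x *: dirv R false) (translate (y *: dirv R true) psi).
  apply/funext => z; rewrite /translate; congr psi.
  rewrite -addrA -opprD; congr (_ - _).
  by congr (_, _); rewrite /= /GRing.scale /= mulr1 mulr0 ?addr0 ?add0r.
have trE' (x y : R) : translate (x, y) psi =
    translate (y *: dirv R true) (translate (x *: dirv R false) psi).
  by rewrite trE translateC.
suff mF : measurable_fun setT F.
  have mr : measurable_fun setT (fun p : tempered_space R * T2 =>
      ((p.1, p.2.1), p.2.2)).
    apply: measurable_fun_pair; last exact: measurableT_comp.
    by apply: measurable_fun_pair => //; exact: measurableT_comp.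
  apply: (eq_measurable_fun (F \o (fun p => ((p.1, p.2.1), p.2.2)))).
    by move=> [phi [x y]].
  exact: measurableT_comp mF mr.
apply: (@measurable_caratheodory _ (tempered_space R * measurableTypeR R)%type)
  => [y|[phi x]]; rewrite /F /=; last first.
  under eq_fun do rewrite trE'.
  by apply: continuous_tempered_translate; exact: schwartz_translate.
apply: (@measurable_caratheodory _ (tempered_space R) R
  (fun q => (q.1 : tempered R) (translate (q.2, y) psi))) => [x|phi] /=.
  exact: measurable_tempered_pairing.
under eq_fun do rewrite trE.
by apply: continuous_tempered_translate; exact: schwartz_translate.
Qed.

(** The mollified field is a pairing with the translates of a single
    function, which brings in the results on translations. *)
Lemma mollifyE eta e (phi : tempered R) (x : plane R) :
  mollify eta e phi x =
  phi (translate x (fun w => e ^- 2 * eta (e^-1 *: - w))).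
Proof.
by congr pairing; apply/funext => y; rewrite /translate opprB.
Qed.

Lemma measurable_mollify eta e :
  measurable_fun setT (fun p : tempered_space R * T2 =>
    mollify eta e p.1 p.2).
Proof.
under eq_fun do rewrite mollifyE; exact: measurable_pairing_translate.
Qed.

Lemma imc_approxE eta alpha f e (phi : tempered R) :
  imc_approx eta alpha f e phi =
  (e `^ (- alpha ^+ 2) *
     \int[@leb2 R]_x (cos (beta_root R * alpha * mollify eta e phi x) * f x)) +i*
  (e `^ (- alpha ^+ 2) *
     \int[@leb2 R]_x (sin (beta_root R * alpha * mollify eta e phi x) * f x)).
Proof.
rewrite /imc_approx /Cintegral.
apply/eqP; rewrite eq_complex /= !mul0r subr0 addr0.
apply/andP; split; apply/eqP; congr (_ * _); apply: eq_Rintegral => x _ /=.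
  by rewrite mulr0 subr0.
by rewrite mulr0 add0r.
Qed.

Lemma measurable_imc_integrand (g : R -> R) eta k f e :
  measurable_fun setT g -> test_function f ->
  measurable_fun setT (fun p : tempered_space R * T2 =>
    g (k * mollify eta e p.1 p.2) * f p.2).
Proof.
move=> mg [sf _]; apply: measurable_funM.
  apply: (measurableT_comp mg); apply: measurable_funM => //.
  exact: measurable_mollify.
apply: measurableT_comp => //; apply: continuous_plane_measurable.
exact: (sf [::]).1.
Qed.

Lemma measurable_imc_integral (g : R -> R) eta k f e :
  measurable_fun setT g -> test_function f ->
  measurable_fun setT (fun phi : tempered_space R =>
    \int[@leb2 R]_x (g (k * mollify eta e phi x) * f x)).
Proof.
move=> mg tf.
pose m : {sigma_finite_measure set T2 -> \bar R} :=
  HB.pack (@lebesgue_measure R \x @lebesgue_measure R)%E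
    (Measure_isSigmaFinite.Build _ _ _ (leb2 R) sigma_finite_leb2).
exact: (measurable_Rintegral_param m (measurable_imc_integrand eta k e mg tf)).
Qed.

Lemma measurable_imc_approx_Re eta alpha f e : test_function f ->
  measurable_fun setT (fun phi : tempered_space R =>
    complex.Re (imc_approx eta alpha f e phi)).
Proof.
move=> tf; under eq_fun do rewrite imc_approxE /=.
apply: measurable_funM => //; apply: measurable_imc_integral => //.
by apply: continuous_measurable_fun; exact: continuous_cos.
Qed.

Lemma measurable_imc_approx_Im eta alpha f e : test_function f ->
  measurable_fun setT (fun phi : tempered_space R =>
    complex.Im (imc_approx eta alpha f e phi)).
Proof.
move=> tf; under eq_fun do rewrite imc_approxE /=.
apply: measurable_funM => //; apply: measurable_imc_integral => //.
by apply: continuous_measurable_fun; exact: continuous_sin.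
Qed.

End measurability.

(** * Complex random variables and limits in probability *)

Lemma fine_oppB (R : numDomainType) (a b : \bar R) :
  fine (a - b)%E = - fine (b - a)%E.
Proof.
case: a => [a||]; case: b => [b||] //=; rewrite ?oppr0 ?oppe0//.
by rewrite opprB.
Qed.

(** When the positive or the negative part has infinite integral, both sides
    are 0, the value of [fine] at infinity. *)
Lemma RintegralN d (T : measurableType d) (R : realType)
    (mu : {measure set T -> \bar R}) (f : T -> R) :
  \int[mu]_x (- f x) = - \int[mu]_x f x.
Proof.
rewrite /Rintegral integralE [in RHS]integralE -fine_oppB.
by congr (fine (_ - _)%E); apply: eq_integral => x _;
  rewrite !(funeposE, funenegE) ?EFinN ?oppeK.
Qed.

Section complex_functions.
Variable R : realType.
Local Notation C := (R[i]^o).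

Lemma normc_geE (r : R) (w : C) : 0 < r ->
  (r%:C <= `|w|) = (r ^+ 2 <= complex.Re w ^+ 2 + complex.Im w ^+ 2).
Proof.
move=> r0; rewrite normc_def lecR.
rewrite -[in RHS](@sqr_sqrtr _ (_ + _)) ?addr_ge0 ?sqr_ge0//.
by rewrite ler_pXn2r// nnegrE ?sqrtr_ge0// ltW.
Qed.

Lemma le_normcE (r : R) (w : C) : (r%:C <= `|w|) = (r <= complex.Re `|w|).
Proof. by rewrite normc_def lecR. Qed.

Lemma Re_normD (v w : C) :
  complex.Re `|v + w| <= complex.Re `|v| + complex.Re `|w|.
Proof. by have := ler_normD v w; rewrite !normc_def -rmorphD lecR. Qed.

Lemma Re_le_norm (w : C) : `|complex.Re w| <= complex.Re `|w|.
Proof.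
rewrite normc_def /= -sqrtr_sqr ler_sqrt ?addr_ge0 ?sqr_ge0//.
by rewrite lerDl sqr_ge0.
Qed.

Lemma Im_le_norm (w : C) : `|complex.Im w| <= complex.Re `|w|.
Proof.
rewrite normc_def /= -sqrtr_sqr ler_sqrt ?addr_ge0 ?sqr_ge0//.
by rewrite lerDr sqr_ge0.
Qed.

Lemma Re_sqrtc_ge0 (w : C) : 0 <= complex.Re (sqrtc w).
Proof. by case: w => a b; rewrite /sqrtc /= sqrtr_ge0. Qed.

(** If s is the root of w with nonnegative real part, then |s - c| <= |s + c|
    because c >= 0, so |s - c|^2 <= |s^2 - c^2| = |w - c^2|. The
    bound holds at c = 0 as well, where the root is not differentiable. *)
Lemma cvg_sqrtc (I : Type) (F : set_system I) {FF : Filter F} (W : I -> C)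
    (c : R) : 0 <= c ->
  complex.Re (W x) @[x --> F] --> c ^+ 2 ->
  complex.Im (W x) @[x --> F] --> (0 : R) ->
  (sqrtc (W x) : C) @[x --> F] --> (c%:C : C).
Proof.
move=> c0 /cvgrPdist_lt cRe /cvgrPdist_lt cIm.
apply/cvgrPdist_lt => -[e e'] /[dup]; rewrite ltcE /= => /andP[/eqP -> e0] _.
have d0 : 0 < e ^+ 2 / 2 by rewrite divr_gt0// exprn_gt0.
near=> x.
have hRe : `|c ^+ 2 - complex.Re (W x)| < e ^+ 2 / 2 by near: x; exact: cRe.
have hIm : `|0 - complex.Im (W x)| < e ^+ 2 / 2 by near: x; exact: cIm.
have := sqr_sqrtc (W x); have := Re_sqrtc_ge0 (W x).
case: (sqrtc (W x)) => p q /= p0 pq.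
move: hRe hIm; rewrite -pq expr2 /= sub0r normrN => hRe hIm.
rewrite normc_def /= ltcR.
rewrite -[ltRHS](ger0_norm (ltW e0)) -sqrtr_sqr ltr_sqrt ?exprn_gt0//.
set D := (c - p) ^+ 2 + (0 - q) ^+ 2.
have D0 : 0 <= D by rewrite addr_ge0 ?sqr_ge0.
set A := c ^+ 2 - (p * p - q * q) in hRe; set B := p * q + q * p in hIm.
(* |s - c|^4 <= |s - c|^2 |s + c|^2 = |w - c^2|^2 *)
have DAB : D ^+ 2 <= A ^+ 2 + B ^+ 2.
  have -> : A ^+ 2 + B ^+ 2 = D * ((c + p) ^+ 2 + q ^+ 2) by rewrite /A /B /D; ring.
  rewrite expr2 ler_wpM2l// /D; nra.
have sq (y : R) : `|y| < e ^+ 2 / 2 -> y ^+ 2 < (e ^+ 2 / 2) ^+ 2.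
  by move=> ye; rewrite -(real_normK (num_real y)) ltr_pXn2r ?nnegrE// ltW.
have hA := sq _ hRe; have hB := sq _ hIm.
rewrite -(@ltr_pXn2r _ 2) ?nnegrE ?sqr_ge0//.
apply: (le_lt_trans DAB); apply: (lt_trans (ltrD hA hB)).
have -> : (e ^+ 2 / 2) ^+ 2 + (e ^+ 2 / 2) ^+ 2 = (e ^+ 2) ^+ 2 / 2 by field.
by rewrite ltr_pdivrMr// ltr_pMr ?exprn_gt0// ltr1n.
Unshelve. all: by end_near. Qed.

End complex_functions.

Section limit_in_probability.
Context d (T : measurableType d) (R : realType) (P : probability T R).
Local Notation C := (R[i]^o).

Definition complex_measurable (X : T -> C) : Prop :=
  measurable_fun setT (fun t => complex.Re (X t)) /\
  measurable_fun setT (fun t => complex.Im (X t)).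

Lemma complex_measurableB (X Y : T -> C) :
  complex_measurable X -> complex_measurable Y ->
  complex_measurable (fun t => X t - Y t).
Proof.
move=> [rX iX] [rY iY]; split.
  rewrite (_ : (fun _ => _) = (fun t => complex.Re (X t) - complex.Re (Y t))).
    exact: measurable_funB.
  by apply/funext => t; case: (X t) (Y t) => ? ? [? ?].
rewrite (_ : (fun _ => _) = (fun t => complex.Im (X t) - complex.Im (Y t))).
  exact: measurable_funB.
by apply/funext => t; case: (X t) (Y t) => ? ? [? ?].
Qed.

Lemma complex_measurableM (X Y : T -> C) :
  complex_measurable X -> complex_measurable Y ->
  complex_measurable (fun t => X t * Y t).
Proof.
move=> [rX iX] [rY iY]; split.
  rewrite (_ : (fun _ => _) = (fun t => complex.Re (X t) * complex.Re (Y t) -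
    complex.Im (X t) * complex.Im (Y t))).
    by apply: measurable_funB; exact: measurable_funM.
  by apply/funext => t; case: (X t) (Y t) => ? ? [? ?].
rewrite (_ : (fun _ => _) = (fun t => complex.Re (X t) * complex.Im (Y t) +
    complex.Im (X t) * complex.Re (Y t))).
  by apply: measurable_funD; exact: measurable_funM.
by apply/funext => t; case: (X t) (Y t) => ? ? [? ?].
Qed.

Lemma measurable_normc_ge (X : T -> C) (r : R) : complex_measurable X ->
  0 < r -> measurable [set t | r%:C <= `|X t|].
Proof.
move=> [rX iX] r0.
pose N t := complex.Re (X t) ^+ 2 + complex.Im (X t) ^+ 2.
have mN : measurable_fun setT N.
  by apply: measurable_funD; exact: measurable_funX.
rewrite (_ : [set t | _] = N @^-1` `[r ^+ 2, +oo[%classic).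
  by rewrite -[X in measurable X]setTI; exact: mN.
by apply/seteqP; split => t /=; rewrite normc_geE// in_itv /= andbT.
Qed.

(** Where |X - Y| >= 2 r, one of |A i - X| and |A i - Y| is at least r; the
    probability of the former event is thus 0 for all r. *)
Lemma limit_in_probability_unique (I : Type) (F : set_system I)
    {FF : ProperFilter F} (A : I -> T -> C) (X Y : T -> C) :
  (forall i, complex_measurable (A i)) ->
  complex_measurable X -> complex_measurable Y ->
  (forall r : R, 0 < r -> P [set t | r%:C <= `|A i t - X t|] @[i --> F] --> 0%E) ->
  (forall r : R, 0 < r -> P [set t | r%:C <= `|A i t - Y t|] @[i --> F] --> 0%E) ->
  {ae P, forall t, X t = Y t}.
Proof.
move=> mA mX mY AX AY.
pose S (n : nat) := [set t | (n.+1%:R^-1 : R)%:C <= `|X t - Y t|].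
have n0 (n : nat) : 0 < n.+1%:R^-1 :> R by rewrite invr_gt0.
have mS n : measurable (S n).
  by apply: measurable_normc_ge => //; exact: complex_measurableB.
have S0 n : P (S n) = 0%E.
  apply/eqP; rewrite eq_le measure_ge0 andbT.
  set r : R := n.+1%:R^-1 / 2.
  have r0 : 0 < r by rewrite divr_gt0.
  have : (P [set t | (r%:C <= `|A i t - X t|)%R] +
      P [set t | (r%:C <= `|A i t - Y t|)%R])%E @[i --> F] --> (0 + 0)%E.
    by apply: cvgeD => //; [exact: AX|exact: AY].
  rewrite adde0 => /cvge_to_ge; apply; apply: nearW => i.
  have mAX := measurable_normc_ge (complex_measurableB (mA i) mX) r0.
  have mAY := measurable_normc_ge (complex_measurableB (mA i) mY) r0.
  apply: le_trans (measureU2 P mAX mAY).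
  apply: le_measure; rewrite ?inE//; first exact: measurableU.
  move=> t; rewrite /S /= => nXY.
  move: nXY; rewrite !le_normcE (splitr n.+1%:R^-1) -/r => nXY.
  have [h|h] := leP r (complex.Re `|A i t - X t|); first by left.
  have [h'|h'] := leP r (complex.Re `|A i t - Y t|); first by right.
  exfalso; move: nXY; apply/negP; rewrite -ltNge.
  have -> : X t - Y t = - (A i t - X t) + (A i t - Y t) by ring.
  by rewrite (le_lt_trans (Re_normD _ _))// normrN ltrD.
apply: (@negligibleS _ _ _ _ (\bigcup_n S n)); last first.
  apply: negligible_bigcup => n; exists (S n); split; [exact: mS|exact: S0|by []].
move=> t /= XY.
have XY0 : 0 < complex.Re `|X t - Y t|.
  have : 0 < `|X t - Y t| by rewrite normr_gt0 subr_eq0; exact/eqP.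
  by rewrite normc_def ltcE /= => /andP[].
exists (Num.truncn (complex.Re `|X t - Y t|)^-1) => //; rewrite /S /= le_normcE.
by rewrite invf_ple ?posrE// ltW// truncnS_gt.
Qed.

End limit_in_probability.

(** * Reflection and translation of the imaginary chaos *)

Section at_infinity.
Variable R : realType.

Global Instance at_infty_filter : Filter (@at_infty R).
Proof.
split.
- by exists 0.
- move=> A B [r rA] [s sB]; exists (Num.max r s) => x.
  by rewrite gt_max => /andP[rx sx]; split; [exact: rA|exact: sB].
- by move=> A B AB [r rA]; exists r => x rx; apply/AB/rA.
Qed.

Lemma at_infty_opp : - x @[x --> @at_infty R] --> @at_infty R.
Proof.
by move=> A [r rA]; exists r => x rx; apply: rA; rewrite normrN.
Qed.

End at_infinity.

Section imaginary_chaos.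
Variable R : realType.
Local Notation C := (R[i]^o).

Lemma test_function_translate (a : plane R) f :
  test_function f -> test_function (translate a f).
Proof.
move=> [sf [r rf]]; split; first exact: smooth_translate.
exists (r + `|a|) => x rx; apply: rf.
have := ler_normD (x - a) a; rewrite subrK => /(lt_le_trans rx).
by rewrite ltrD2r.
Qed.

Lemma mollify_ttranslate eta e (a : plane R) (phi : tempered R) x :
  mollify eta e (ttranslate a phi) x = mollify eta e phi (x - a).
Proof.
rewrite /mollify /ttranslate /=; congr pairing; apply/funext => y.
by rewrite /translate opprK opprD addrA addrAC.
Qed.

(** The exponential of -alpha is the conjugate of that of alpha, f is real, and
    the integral over the plane absorbs the translation. *)
Lemma imc_approx_reflect_translate eta alpha f e (a : plane R) (phi : tempered R) :
  test_function f ->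
  imc_approx eta (- alpha) (translate a f) e phi =
  (imc_approx eta alpha f e (ttranslate (- a) phi))^*%C.
Proof.
move=> tf; rewrite !imc_approxE sqrrN.
have mt := leb2_measure_preserving_shift (- a).
have shiftE (g : R -> R) : measurable_fun setT g ->
  \int[@leb2 R]_x (g (beta_root R * alpha * mollify eta e phi x) * f (x - a)) =
  \int[@leb2 R]_x (g (beta_root R * alpha *
     mollify eta e (ttranslate (- a) phi) x) * f x).
  move=> mg.
  have mh := measurable_fun_pair2 (ttranslate (- a) phi : tempered_space R)
    (measurable_imc_integrand eta (beta_root R * alpha) e mg tf).
  rewrite -[RHS](Rintegral_measure_preserving mt mh).
  by apply: eq_Rintegral => x _; rewrite mollify_ttranslate opprK subrK.
apply/eqP; rewrite eq_complex /=; apply/andP; split; apply/eqP.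
  congr (_ * _); rewrite -shiftE; last first.
    by apply: continuous_measurable_fun; exact: continuous_cos.
  by apply: eq_Rintegral => x _; rewrite mulrN mulNr cosN.
rewrite -[RHS]mulrN; congr (_ * _); rewrite -shiftE; last first.
  by apply: continuous_measurable_fun; exact: continuous_sin.
rewrite -RintegralN.
by apply: eq_Rintegral => x _; rewrite mulrN mulNr sinN mulNr.
Qed.

Lemma complex_measurable_conj_translate (X : tempered_space R -> C)
    (a : plane R) : complex_measurable X ->
  complex_measurable (fun phi : tempered_space R => (X (ttranslate a phi))^*%C).
Proof.
have mt := measurable_ttranslate a.
move=> [rX iX]; split.
  rewrite (_ : (fun _ => _) = (fun phi => complex.Re (X phi)) \o (ttranslate a)).
    exact: measurableT_comp.
  by apply/funext => phi /=; case: (X _).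
rewrite (_ : (fun _ => _) =
  -%R \o ((fun phi => complex.Im (X phi)) \o (ttranslate a))).
  by apply: measurableT_comp => //; exact: measurableT_comp.
by apply/funext => phi /=; case: (X _).
Qed.

Variables (nu : probability (tempered_space R) R).
Hypothesis inv : translation_invariant nu.

Lemma ttranslate_measure_preserving (a : plane R) :
  measure_preserving nu (ttranslate a : tempered_space R -> tempered_space R).
Proof. by split; [exact: measurable_ttranslate|exact: inv]. Qed.

(** Both sides are limits in probability of the regularised chaos of order
    - alpha: the left side by definition, the right side because
    [imc_approx_reflect_translate] and the invariance of nu turn its error into
    that of the chaos of order alpha. *)
Lemma imc_reflect_translate eta (alpha : R)
    (Mp Mm : (plane R -> R) -> tempered_space R -> C) f (a : plane R) :
  is_imc nu eta alpha Mp -> is_imc nu eta (- alpha) Mm -> test_function f ->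
  {ae nu, forall phi, Mm (translate a f) phi =
                      (Mp f (ttranslate (- a) phi))^*%C}.
Proof.
move=> Hp Hm tf; have taf := test_function_translate a tf.
have [mt pt] := ttranslate_measure_preserving (- a).
have mA alpha' g e : test_function g ->
    complex_measurable (fun phi : tempered_space R =>
      imc_approx eta alpha' g e phi : C).
  by split; [exact: measurable_imc_approx_Re|exact: measurable_imc_approx_Im].
have mMp : complex_measurable (Mp f).
  by split; [exact: (imc_measurable_Re Hp)|exact: (imc_measurable_Im Hp)].
have mMm : complex_measurable (Mm (translate a f)).
  by split; [exact: (imc_measurable_Re Hm)|exact: (imc_measurable_Im Hm)].
apply: (limit_in_probability_unique (F := 0^'+)
  (A := fun e (phi : tempered_space R) => imc_approx eta (- alpha) (translate a f) e phi)).
- by move=> e; exact: mA.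
- exact: mMm.
- exact: complex_measurable_conj_translate.
- by move=> r r0; exact: (imc_cvg_in_probability Hm taf r0).
move=> r r0.
have E e : nu [set phi : tempered_space R |
      r%:C <= `|imc_approx eta (- alpha) (translate a f) e phi -
                (Mp f (ttranslate (- a) phi))^*%C|] =
    nu [set phi : tempered_space R |
      r%:C <= `|imc_approx eta alpha f e phi - Mp f phi|].
  rewrite -[RHS]pt; last first.
    by apply: measurable_normc_ge => //; apply: complex_measurableB => //; exact: mA.
  congr (nu _); apply/seteqP; split => phi /=;
    by rewrite imc_approx_reflect_translate// -rmorphB normcJ.
by under eq_fun do rewrite E; exact: (imc_cvg_in_probability Hp tf r0).
Qed.

End imaginary_chaos.

(** * Decorrelation and the one-point function *)

Section decorrelation.
Context (R : realType) (nu : probability (tempered_space R) R).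
Local Notation C := (R[i]^o).
Hypotheses (inv : translation_invariant nu) (mix : mixing nu).

Lemma decorrelation (X Y : tempered_space R -> R) :
  measurable_fun setT X -> measurable_fun setT Y ->
  nu.-integrable setT (EFin \o (fun phi => X phi ^+ 4)) ->
  nu.-integrable setT (EFin \o (fun phi => Y phi ^+ 4)) ->
  \int[nu]_phi (X phi * Y (ttranslate (- x) phi)) @[x --> @at_infty R] -->
  \int[nu]_phi X phi * \int[nu]_phi Y phi.
Proof.
apply: (mixing_Rintegral
  (tau := fun x => ttranslate (- x) : tempered_space R -> tempered_space R)).
  by move=> x; exact: ttranslate_measure_preserving.
move=> A B mA mB; exact: cvg_comp (@at_infty_opp R) (mix mA mB).
Qed.

(** From |a b| <= (a^2 + b^2) / 2 and u <= u^2 + 1 / 4. *)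
Lemma integrable_translate_product (X Y : tempered_space R -> R) (x : plane R) :
  measurable_fun setT X -> measurable_fun setT Y ->
  nu.-integrable setT (EFin \o (fun phi => X phi ^+ 4)) ->
  nu.-integrable setT (EFin \o (fun phi => Y phi ^+ 4)) ->
  nu.-integrable setT (EFin \o (fun phi => X phi * Y (ttranslate x phi))).
Proof.
move=> mX mY iX iY; have mp := ttranslate_measure_preserving inv x.
have iYt : nu.-integrable setT (EFin \o (fun phi => Y (ttranslate x phi) ^+ 4)).
  exact: (integrable_measure_preserving (f := fun phi => Y phi ^+ 4) mp).
have ic : nu.-integrable setT (EFin \o cst (1 : R)).
  exact: finite_measure_integrable_cst.
have iG : nu.-integrable setT
    (EFin \o (fun phi => (X phi ^+ 4 + Y (ttranslate x phi) ^+ 4) + 1)).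
  by have := integrableD measurableT (integrableD measurableT iX iYt) ic.
apply: integrable_dominated iG.
  by apply: measurable_funM => //; exact: measurableT_comp mY mp.1.
move=> phi; set a := X phi; set b := Y _.
have hab := sqr_ge0 (a + b); have hab' := sqr_ge0 (a - b).
have ha := sqr_ge0 (a ^+ 2 - 2^-1); have hb := sqr_ge0 (b ^+ 2 - 2^-1).
by rewrite ler_norml; apply/andP; split; lra.
Qed.

(** With F = X + i Y, the real and imaginary parts of F * conj (F o tau) are
    X X' + Y Y' and Y X' - X Y', where X' = X o tau and Y' = Y o tau;
    [decorrelation] applies to each of the four products. *)
Lemma decorrelation_complex (F : tempered_space R -> C) (c : R) :
  complex_measurable F ->
  nu.-integrable setT (fun phi => (complex.Re `|F phi| ^+ 4)%:E) ->
  Cintegral nu F = c%:C ->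
  let W x := Cintegral nu (fun phi => F phi * (F (ttranslate (- x) phi))^*%C) in
  complex.Re (W x) @[x --> @at_infty R] --> c ^+ 2 /\
  complex.Im (W x) @[x --> @at_infty R] --> (0 : R).
Proof.
move=> [mX mY] iF [EX EY] W.
set X := fun phi => complex.Re (F phi) in mX EX.
set Y := fun phi => complex.Im (F phi) in mY EY.
have i4 (Z : tempered_space R -> R) : measurable_fun setT Z ->
    (forall phi, `|Z phi| <= complex.Re `|F phi|) ->
    nu.-integrable setT (EFin \o (fun phi => Z phi ^+ 4)).
  move=> mZ ZF; apply: integrable_dominated iF; first exact: measurable_funX.
  by move=> phi; rewrite normrX lerXn2r ?nnegrE// (le_trans _ (ZF phi)).
have iX := i4 _ mX (fun phi => Re_le_norm (F phi)).
have iY := i4 _ mY (fun phi => Im_le_norm (F phi)).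
have iXX x := integrable_translate_product (- x) mX mX iX iX.
have iXY x := integrable_translate_product (- x) mX mY iX iY.
have iYX x := integrable_translate_product (- x) mY mX iY iX.
have iYY x := integrable_translate_product (- x) mY mY iY iY.
have ReW x : complex.Re (W x) =
    \int[nu]_phi (X phi * X (ttranslate (- x) phi)) +
    \int[nu]_phi (Y phi * Y (ttranslate (- x) phi)).
  rewrite /W /Cintegral /= -RintegralD//; apply: eq_Rintegral => phi _.
  by rewrite /X /Y; case: (F phi) => a b; case: (F _) => a' b' /=; ring.
have ImW x : complex.Im (W x) =
    \int[nu]_phi (Y phi * X (ttranslate (- x) phi)) -
    \int[nu]_phi (X phi * Y (ttranslate (- x) phi)).
  rewrite /W /Cintegral /= -RintegralB//; apply: eq_Rintegral => phi _.
  by rewrite /X /Y; case: (F phi) => a b; case: (F _) => a' b' /=; ring.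
split.
  under eq_fun do rewrite ReW.
  have -> : c ^+ 2 = \int[nu]_phi X phi * \int[nu]_phi X phi +
      \int[nu]_phi Y phi * \int[nu]_phi Y phi.
    by rewrite EX EY; ring.
  by apply: cvgD; exact: decorrelation.
under eq_fun do rewrite ImW.
have -> : 0 = \int[nu]_phi Y phi * \int[nu]_phi X phi -
    \int[nu]_phi X phi * \int[nu]_phi Y phi by ring.
by apply: cvgB; exact: decorrelation.
Qed.

End decorrelation.

Lemma eq_Cintegral_ae d (T : measurableType d) (R : realType)
    (mu : {measure set T -> \bar R}) (F G : T -> R[i]^o) :
  complex_measurable F -> complex_measurable G ->
  {ae mu, forall t, F t = G t} -> Cintegral mu F = Cintegral mu G.
Proof.
move=> [rF iF] [rG iG] FG; rewrite /Cintegral /Rintegral; congr (fine _ +i* fine _);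
  apply: ae_eq_integral => //; try exact/measurable_EFinP;
  by apply: filterS FG => t -> _.
Qed.

Theorem corollary1p16 (R : realType)
  (gff : R -> R -> probability (field_space R) R)
  (hgff : forall m e : R, 0 < m -> 0 < e -> is_gff m e (gff m e))
  (z : R) (hz : z != 0)
  (nu : probability (tempered_space R) R)
  (hnu : is_massless_sine_gordon gff z nu)
  (eta : plane R -> R) (heta : is_mollifier eta)
  (M : R -> (plane R -> R) -> tempered_space R -> R[i]^o)
  (hM : forall a : R, -1 < a < 1 -> is_imc nu eta a (M a))
  (alpha : R) (halpha : -1 < alpha < 1)
  (c : R) (hc : is_one_point_function nu (M alpha) c)
  (g : plane R -> R) (hg : test_function g)
  (hg1 : \int[@leb2 R]_x g x = 1) :
  c%:C = Cintegral nu (M alpha g) /\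
  (sqrtc (Cintegral nu (fun phi => M alpha g phi * M (- alpha) (translate x g) phi)) : R[i]^o)
    @[x --> @at_infty R] --> (c%:C : R[i]^o).
Proof.
have cE : Cintegral nu (M alpha g) = c%:C.
  by rewrite (one_pointE hc hg) hg1 mulr1.
split; first by rewrite cE.
have inv := sg_translation_invariant hnu; have mix := sg_mixing hnu.
have hMp := hM _ halpha.
have hMm : is_imc nu eta (- alpha) (M (- alpha)).
  by apply: hM; move: halpha => /andP[? ?]; apply/andP; split; lra.
have mF : complex_measurable (M alpha g).
  by split; [exact: (imc_measurable_Re hMp)|exact: (imc_measurable_Im hMp)].
pose W x := Cintegral nu (fun phi =>
  M alpha g phi * (M alpha g (ttranslate (- x) phi))^*%C).
have WE x : Cintegral nu (fun phi =>
    M alpha g phi * M (- alpha) (translate x g) phi) = W x.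
  have tg := test_function_translate x hg.
  apply: eq_Cintegral_ae.
  - apply: complex_measurableM => //; split.
      exact: (imc_measurable_Re hMm).
    exact: (imc_measurable_Im hMm).
  - apply: complex_measurableM => //.
    exact: complex_measurable_conj_translate.
  have := imc_reflect_translate inv x hMp hMm hg.
  by apply: filterS => phi ->.
have [WRe WIm] := decorrelation_complex inv mix mF (imc_moments hMp hg 4) cE.
under eq_fun do rewrite WE.
exact: cvg_sqrtc (one_point_ge0 hc) WRe WIm.
Qed.
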